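(* Let $C_{(=,\geq)}(x,y)$ be the bivariate generating function of the Catalan words avoiding the ordered pair of relations $(=,\geq)$, where $x$ marks the length and $y$ marks the number of descents. Then $$C_{(=,\geq)}(x,y)=\frac{1 - x - x^2 + 2 x y - \sqrt{(1 - x - x^2 + 2 x y)^2 - 4 x y (1 + x y)}}{2xy}.$$
   Context: A Catalan word of length $n$ is a word $w=w_1w_2\cdots w_n$ over the non-negative integers with $w_1=0$ and $0\leq w_i\leq w_{i-1}+1$ for $i=2,\dots,n$; the empty word is the unique Catalan word of length $0$. For relations $X,Y\in\{<,>,\leq,\geq,=,\neq\}$, a word $w$ contains the pattern $(X,Y)$ if there is an index $i\geq 1$ (with $i+2\le n$) such that $w_i\,X\,w_{i+1}$ and $w_{i+1}\,Y\,w_{i+2}$; otherwise $w$ avoids $(X,Y)$. The number of descents $\mathrm{des}(w)$ is the number of indices $i$ with $w_i>w_{i+1}$. The bivariate generating function is $C_{(X,Y)}(x,y)=\sum_{w}x^{|w|}y^{\mathrm{des}(w)}$, the sum being over all Catalan words $w$ (of any length $|w|\geq 0$) avoiding $(X,Y)$. Identities are between formal power series in $x$ with coefficients polynomials in $y$ (after clearing denominators); the square root of a power series with constant term $1$ is the one with constant term $1$. *)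

(* Defs.v *)
From HB Require Import structures.
From mathcomp Require Import all_boot all_order all_algebra.
From mathcomp Require Import boolp.

Set Implicit Arguments.
Unset Strict Implicit.
Unset Printing Implicit Defensive.

Import GRing.Theory.
Local Open Scope ring_scope.

Record fps (R : Type) := Fps { fps_coef : nat -> R }.

Notation "f `[ n ]" := (fps_coef f n)
  (at level 2, n at level 200, left associativity, format "f `[ n ]").

Section FpsRing.
Variable R : comNzRingType.
Implicit Types (f g h : fps R).

Lemma fpsP f g : (forall n, f`[n] = g`[n]) -> f = g.
Proof. by case: f g => [f] [g] /= /funext ->. Qed.

HB.instance Definition _ := gen_eqMixin (fps R).
HB.instance Definition _ := gen_choiceMixin (fps R).

Definition fps_zero : fps R := Fps (fun=> 0).
Definition fps_add f g : fps R := Fps (fun n => f`[n] + g`[n]).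
Definition fps_opp f : fps R := Fps (fun n => - f`[n]).

Fact fps_addA : associative fps_add.
Proof. by move=> f g h; apply: fpsP => n /=; rewrite addrA. Qed.
Fact fps_addC : commutative fps_add.
Proof. by move=> f g; apply: fpsP => n /=; rewrite addrC. Qed.
Fact fps_add0 : left_id fps_zero fps_add.
Proof. by move=> f; apply: fpsP => n /=; rewrite add0r. Qed.
Fact fps_addN : left_inverse fps_zero fps_opp fps_add.
Proof. by move=> f; apply: fpsP => n /=; rewrite addNr. Qed.

HB.instance Definition _ :=
  GRing.isZmodule.Build (fps R) fps_addA fps_addC fps_add0 fps_addN.

Definition fpsC (c : R) : fps R := Fps (fun n => if n == 0%N then c else 0).
Definition fps_mul f g : fps R :=
  Fps (fun n => \sum_(i < n.+1) f`[i] * g`[n - i]).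

(* Products of series are computed on truncations, which are polynomials. *)
Let trunc n f : {poly R} := \poly_(i < n) f`[i].

Let coef_trunc_mul f g n k :
  (k < n)%N -> (fps_mul f g)`[k] = (trunc n f * trunc n g)`_k.
Proof.
move=> ltkn; rewrite coefM /=; apply: eq_bigr => i _; rewrite !coef_poly.
by rewrite (leq_ltn_trans (leq_subr _ _) ltkn) (leq_ltn_trans _ ltkn) // -ltnS.
Qed.

Let coefM_eq (p q r s : {poly R}) k :
  (forall i, (i <= k)%N -> p`_i = r`_i) -> (forall i, (i <= k)%N -> q`_i = s`_i) ->
  (p * q)`_k = (r * s)`_k.
Proof.
move=> pr qs; rewrite !coefM; apply: eq_bigr => i _.
by rewrite pr -1?ltnS // qs // leq_subr.
Qed.

Fact fps_mulA : associative fps_mul.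
Proof.
move=> f g h; apply: fpsP => k.
rewrite !(@coef_trunc_mul _ _ k.+1) //.
transitivity (trunc k.+1 f * trunc k.+1 g * trunc k.+1 h)`_k.
  rewrite -mulrA; apply: coefM_eq => // i leik.
  by rewrite coef_poly ltnS leik (@coef_trunc_mul _ _ k.+1).
apply: coefM_eq => // i leik.
by rewrite coef_poly ltnS leik (@coef_trunc_mul _ _ k.+1).
Qed.

Fact fps_mulC : commutative fps_mul.
Proof.
by move=> f g; apply: fpsP => k; rewrite !(@coef_trunc_mul _ _ k.+1) // mulrC.
Qed.

Fact fps_mul1 : left_id (fpsC 1) fps_mul.
Proof.
move=> f; apply: fpsP => n /=; rewrite big_ord_recl /= mul1r subn0.
by rewrite big1 ?addr0 // => i _; rewrite mul0r.
Qed.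

Fact fps_mulDl : left_distributive fps_mul fps_add.
Proof.
move=> f g h; apply: fpsP => n /=; rewrite -big_split /=.
by apply: eq_bigr => i _; rewrite mulrDl.
Qed.

Fact fps_1neq0 : fpsC 1 != 0 :> fps R.
Proof. by apply/eqP => /(congr1 (fun f => f`[0])) /= /eqP; rewrite oner_eq0. Qed.

HB.instance Definition _ := GRing.Zmodule_isComNzRing.Build (fps R)
  fps_mulA fps_mulC fps_mul1 fps_mulDl fps_1neq0.

Definition fpsX : fps R := Fps (fun n => (n == 1%N)%:R).

Lemma coef_fps0 n : (0 : fps R)`[n] = 0. Proof. by []. Qed.
Lemma coef_fps1 n : (1 : fps R)`[n] = (n == 0%N)%:R. Proof. by case: n. Qed.
Lemma coef_fpsD f g n : (f + g)`[n] = f`[n] + g`[n]. Proof. by []. Qed.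
Lemma coef_fpsN f n : (- f)`[n] = - f`[n]. Proof. by []. Qed.
Lemma coef_fpsM f g n : (f * g)`[n] = \sum_(i < n.+1) f`[i] * g`[n - i].
Proof. by []. Qed.
Lemma coef_fpsC c n : (fpsC c)`[n] = if n == 0%N then c else 0.
Proof. by []. Qed.
Lemma coef_fpsX n : fpsX`[n] = (n == 1%N)%:R. Proof. by []. Qed.

Lemma coef_fpsCM c f n : (fpsC c * f)`[n] = c * f`[n].
Proof.
rewrite coef_fpsM big_ord_recl subn0 big1 ?addr0 // => i _.
by rewrite coef_fpsC mul0r.
Qed.

Lemma coef_fpsXM f n : (fpsX * f)`[n] = if n is m.+1 then f`[m] else 0.
Proof.
rewrite coef_fpsM big_ord_recl coef_fpsX mul0r add0r.
case: n => [|n]; first by rewrite big_ord0.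
rewrite big_ord_recl coef_fpsX mul1r subSS subn0 big1 ?addr0 // => i _.
by rewrite coef_fpsX mul0r.
Qed.

Fact fpsC_is_zmod_morphism : zmod_morphism fpsC.
Proof. by move=> a b; apply: fpsP => -[|n] //=; rewrite subrr. Qed.
Fact fpsC_is_monoid_morphism : monoid_morphism fpsC.
Proof.
by split=> // a b; apply: fpsP => -[|n]; rewrite coef_fpsCM //= mulr0.
Qed.
HB.instance Definition _ :=
  GRing.isZmodMorphism.Build R (fps R) fpsC fpsC_is_zmod_morphism.
HB.instance Definition _ :=
  GRing.isMonoidMorphism.Build R (fps R) fpsC fpsC_is_monoid_morphism.

End FpsRing.

Arguments fpsX {R}.

Section FpsSqrt.
Variable R : comUnitRingType.
Implicit Types (f g : fps R).

(* The coefficients s_0, ..., s_n of the root, obtained by solving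
   f_n = 2 s_n + \sum_(0 < i < n) s_i s_(n-i) for s_n. The value is
   meaningful only if f`[0] = 1 and 2 is invertible: see fps_sqrtK and
   fps_sqrt_uniq. *)
Fixpoint fps_sqrt_seq f n : seq R :=
  if n is m.+1 then
    let s := fps_sqrt_seq f m in
    rcons s (2^-1 * (f`[n] - \sum_(1 <= i < n) s`_i * s`_(n - i)))
  else [:: 1].

Definition fps_sqrt f : fps R := Fps (fun n => (fps_sqrt_seq f n)`_n).

Let size_fps_sqrt_seq f n : size (fps_sqrt_seq f n) = n.+1.
Proof. by elim: n => //= n IHn; rewrite size_rcons IHn. Qed.

Let nth_fps_sqrt_seq f n i :
  (i <= n)%N -> (fps_sqrt_seq f n)`_i = (fps_sqrt f)`[i].
Proof.
elim: n => [|n IHn]; first by rewrite leqn0 => /eqP->.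
rewrite leq_eqVlt => /predU1P[-> //|]; rewrite ltnS => lein.
by rewrite /= nth_rcons size_fps_sqrt_seq ltnS lein IHn.
Qed.

Lemma coef0_fps_sqrt f : (fps_sqrt f)`[0] = 1. Proof. by []. Qed.

Lemma coefS_fps_sqrt f n : (fps_sqrt f)`[n.+1] =
  2^-1 * (f`[n.+1] - \sum_(1 <= i < n.+1) (fps_sqrt f)`[i] * (fps_sqrt f)`[n.+1 - i]).
Proof.
rewrite [LHS]/= nth_rcons size_fps_sqrt_seq ltnn eqxx.
congr (_ * (_ - _)); apply: eq_big_nat => -[//|i] /andP[_ lein].
by rewrite !nth_fps_sqrt_seq // ?subSS ?leq_subr // ltnW.
Qed.

Let coefS_sqr g n : g`[0] = 1 -> (g ^+ 2)`[n.+1] =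
  2 * g`[n.+1] + \sum_(1 <= i < n.+1) g`[i] * g`[n.+1 - i].
Proof.
move=> g0; rewrite expr2 coef_fpsM -(big_mkord xpredT (fun i => g`[i] * g`[n.+1 - i])).
rewrite big_nat_recr //= big_nat_recl // subnn g0 mul1r mulr1 subn0.
by rewrite big_add1 /= addrAC -mulr2n mulr_natl.
Qed.

Hypothesis unit2 : (2 : R) \is a GRing.unit.

Lemma fps_sqrtK f : f`[0] = 1 -> fps_sqrt f ^+ 2 = f.
Proof.
move=> f0; apply: fpsP => -[|n].
  by rewrite expr2 coef_fpsM big_ord1 !coef0_fps_sqrt mulr1 f0.
by rewrite coefS_sqr // coefS_fps_sqrt mulrA divrr // mul1r subrK.
Qed.

Lemma fps_sqrt_uniq f g : g`[0] = 1 -> g ^+ 2 = f -> g = fps_sqrt f.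
Proof.
move=> g0 gf; apply: fpsP => n; elim/ltn_ind: n => -[|n] IHn.
  by rewrite g0.
have := coefS_sqr n g0; rewrite gf => fn.
rewrite coefS_fps_sqrt fn -[LHS](mulKr unit2); congr (_ * _).
rewrite -[LHS](addrK (\sum_(1 <= i < n.+1) g`[i] * g`[n.+1 - i])).
congr (_ - _); apply: eq_big_nat => -[//|i] /andP[_ lein].
by rewrite -!IHn // subSS ltnS leq_subr.
Qed.

End FpsSqrt.

(* The letter w_i of the literature is [nth 0 w (i - 1)]. *)
Definition catalan_word (w : seq nat) : bool :=
  (head 0%N w == 0%N) && sorted (fun a b => (b <= a.+1)%N) w.

Definition contains (X Y : rel nat) (w : seq nat) : bool :=
  has (fun i => X (nth 0%N w i) (nth 0%N w i.+1)
             && Y (nth 0%N w i.+1) (nth 0%N w i.+2))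
      (iota 0 (size w - 2)).

Definition avoids (X Y : rel nat) (w : seq nat) : bool := ~~ contains X Y w.

Definition des (w : seq nat) : nat :=
  count (fun i => (nth 0%N w i > nth 0%N w i.+1)%N) (iota 0 (size w - 1)).

(* The letters of a Catalan word of length n are all smaller than n, so that
   the following list is complete: see mem_catalan_words. *)
Definition catalan_words (n : nat) : seq (seq nat) :=
  [seq w <- [seq map val (tval t) | t <- enum {: n.-tuple 'I_n}]
   | catalan_word w].

Lemma catalan_words_uniq n : uniq (catalan_words n).
Proof.
rewrite filter_uniq // map_inj_uniq ?enum_uniq // => s t.
by move/(inj_map val_inj)/val_inj.
Qed.

Lemma catalan_word_ltn w : catalan_word w -> all (fun a => a < size w)%N w.
Proof.
case/andP=> w0 /(sortedP 0%N) wS; apply/(all_nthP 0%N) => i ltiw.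
apply: leq_ltn_trans ltiw; elim: i => [|i IHi] in w0 wS *.
  by rewrite nth0 (eqP w0).
have [ltiw|leiw] := ltnP i.+1 (size w); last by rewrite nth_default.
by apply: leq_trans (wS _ ltiw) _; rewrite ltnS IHi.
Qed.

Lemma mem_catalan_words n w :
  (w \in catalan_words n) = catalan_word w && (size w == n).
Proof.
rewrite mem_filter; apply: andb_id2l => Cw.
apply/mapP/eqP => [[t _ ->]|szw]; first by rewrite size_map size_tuple.
have ltw := catalan_word_ltn Cw; rewrite szw in ltw.
have sz : size (pmap (insub : nat -> option 'I_n) w) == n.
  by rewrite size_pmap_sub -{2}szw -all_count.
exists (Tuple sz); rewrite ?mem_enum //=.
rewrite pmap_filter; last exact: insubK.
by symmetry; apply/all_filterP/allP => a /(allP ltw) lta; rewrite insubT.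
Qed.

(* The series variable is x; the variable 'X of the coefficients is y. *)
Definition catalan_gf (X Y : rel nat) : fps {poly rat} :=
  Fps (fun n => \sum_(w <- catalan_words n | avoids X Y w) 'X^(des w)).

(* Main.v *)
(** Cut a nonempty Catalan word before its second 0 as [0 (u + 1) v], with [u]
    and [v] Catalan words. A nonempty [u] followed by a nonempty [v] creates a
    descent, and a forbidden factor at the junction exactly when [u] ends with
    two equal letters; an empty [u] creates a forbidden factor exactly when [v]
    starts with two equal letters. Let P, A and N count the nonempty avoiding
    words that are arbitrary, do not start, or do not end with two equal
    letters, respectively. Then P = A + xA, A = x(1 + P + yNP) and, since an
    avoiding word ends with two equal letters iff it comes from a word counted
    by N by doubling its last letter, P = N + xN. Eliminating A and N gives
    P = x(1 + x)(1 + P) + xyP^2, and C = 1 + P. *)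

Require Import Defs.
From mathcomp Require Import all_boot all_order all_algebra.
From mathcomp Require Import ring.

Import GRing.Theory.
Local Open Scope ring_scope.

(** * Recursions for avoidance and descents on words *)

Section Words.
Local Open Scope nat_scope.
Implicit Types (a b c : nat) (u v w : seq nat).

Local Notation avoiding := (avoids eq_op geq).

Lemma contains_cons3 (X Y : rel nat) a b c w :
  contains X Y [:: a, b, c & w] = X a b && Y b c || contains X Y [:: b, c & w].
Proof. by rewrite /contains /= !subSS !subn0 /= (iotaDl 1 0) has_map. Qed.

Lemma avoids_cons3 a b c w :
  avoiding [:: a, b, c & w] = ~~ ((a == b) && (c <= b)) && avoiding [:: b, c & w].
Proof. by rewrite /avoids contains_cons3 negb_or. Qed.

Lemma des_cons2 a b w : des [:: a, b & w] = (b < a) + des (b :: w).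
Proof. by rewrite /des /= !subSS !subn0 /= (iotaDl 1 0) count_map. Qed.

Definition starts_eq w := if w is [:: a, b & _] then a == b else false.

Fixpoint ends_eq w :=
  if w is a :: w' then
    match w' with [::] => false | [:: b] => a == b | _ => ends_eq w' end
  else false.

Lemma ends_eq_rcons2 w a b : ends_eq (rcons (rcons w a) b) = (a == b).
Proof. by elim: w => // c [|d [|e w]] // IHw; rewrite -IHw. Qed.

Lemma des_map_succn w : des (map succn w) = des w.
Proof. by elim: w => // a [|b w] // IHw; rewrite /= !des_cons2 -IHw. Qed.

Lemma avoids_map_succn w : avoiding (map succn w) = avoiding w.
Proof. by elim: w => // a [|b [|c w]] // IHw; rewrite /= !avoids_cons3 -IHw. Qed.

Lemma ends_eq_map_succn w : ends_eq (map succn w) = ends_eq w.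
Proof. by elim: w => // a [|b [|c w]] // IHw; rewrite /= -IHw. Qed.

Lemma des_cat a u b v :
  des (a :: u ++ b :: v) = des (a :: u) + des [:: last a u, b & v].
Proof. by elim: u a => [|c u IHu] a //; rewrite /= !des_cons2 IHu des_cons2 addnA. Qed.

(** Two factors straddle the cut. As [b <= last a u], the one made of the last two letters of
    [a :: u] and [b] is forbidden exactly when these letters are equal; the other one survives in
    the last conjunct. *)
Lemma avoids_cat a u b v : b <= last a u ->
  avoiding (a :: u ++ b :: v) =
  [&& avoiding (a :: u), ~~ ends_eq (a :: u) & avoiding [:: last a u, b & v]].
Proof.
elim: u a => [|c [|d u] IHu] a //= leb.
  by rewrite avoids_cons3 leb andbT.
rewrite !avoids_cons3 -cat_cons IHu // andbA.
by rewrite -!andbA.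
Qed.

Lemma des_rcons_last a u : des (rcons (a :: u) (last a u)) = des (a :: u).
Proof. by rewrite -cats1 des_cat des_cons2 ltnn addn0. Qed.

Lemma avoids_rcons_last a u :
  avoiding (rcons (a :: u) (last a u)) = avoiding (a :: u) && ~~ ends_eq (a :: u).
Proof. by rewrite -cats1 avoids_cat // andbT. Qed.

(** * Cutting before the second 0, and doubling the last letter *)

Lemma catalan_word_head a w : catalan_word (a :: w) -> a = 0.
Proof. by case/andP=> /eqP. Qed.

(** With the letters read as the starting heights of the up-steps of a Dyck path, this is the
    decomposition at the first return to the axis. *)
Definition first_return u v := 0 :: map succn u ++ v.

Lemma catalan_first_return u v : head 0 v = 0 ->
  catalan_word (first_return u v) = catalan_word u && catalan_word v.
Proof.
move=> v0; rewrite /catalan_word /= cat_path v0 eqxx /=; congr (_ && _).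
  by case: u => //= a u; rewrite ltnS leqn0 path_map.
by case: v v0 => //= b v ->.
Qed.

(** Without a second 0, [find] returns the size of the tail, so the index is the length of [u] even
    when [v] is empty. *)
Definition return_index w := find (pred1 0) (behead w).

Lemma return_index_first_return u v : head 0 v = 0 ->
  return_index (first_return u v) = size u.
Proof.
move=> v0; rewrite /return_index /= find_cat has_map has_pred0 size_map.
by case: v v0 => [|b v] /= => [_|->]; rewrite addn0.
Qed.

Lemma first_return_inj u v u' v' : size u = size u' ->
  first_return u v = first_return u' v' -> u = u' /\ v = v'.
Proof.
move=> eq_sz [] /eqP; rewrite eqseq_cat ?size_map // => /andP[/eqP equ /eqP ->].
by split=> //; apply: inj_map equ => ? ? [].
Qed.

Lemma first_returnP w : catalan_word w -> w != [::] ->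
  exists u v, w = first_return u v /\ head 0 v = 0.
Proof.
case: w => // a w Cw _; rewrite (catalan_word_head _ _ Cw).
exists (map predn (take (find (pred1 0) w) w)), (drop (find (pred1 0) w) w).
split; last first.
  have [has0|/hasNfind ->] := boolP (has (pred1 0) w); last by rewrite drop_size.
  by rewrite -nth0 nth_drop addn0; apply/eqP/(nth_find 0 has0).
(* Letters before the first 0 of the tail are positive, so [succn] undoes [predn] on them. *)
rewrite /first_return -map_comp map_id_in ?cat_take_drop //= => b b_in.
rewrite prednK // lt0n; apply: contraTneq b_in => ->.
apply/negP => /(nthP 0)[i]; rewrite size_take_min => lti.
have lti' := leq_trans lti (geq_minl _ _).
by rewrite nth_take // => w0; have := before_find 0 lti'; rewrite /= w0.
Qed.

(** Fixing the index fixes the lengths of [u] and [v], and then the cut is a bijection. *)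
Lemma perm_first_return n i : i <= n ->
  perm_eq [seq w <- catalan_words n.+1 | return_index w == i]
          [seq first_return u v | u <- catalan_words i, v <- catalan_words (n - i)].
Proof.
move=> lein; apply: uniq_perm; first exact/filter_uniq/catalan_words_uniq.
  apply: allpairs_uniq; try exact: catalan_words_uniq.
  move=> [u v] [u' v'] /allpairsP[[? ?] [+ _ [-> ->]]] /allpairsP[[? ?] [+ _ [-> ->]]].
  rewrite !mem_catalan_words => /andP[_ /eqP szu] /andP[_ /eqP szu'] /=.
  by case/first_return_inj=> [|-> ->] //; rewrite szu.
move=> w; rewrite mem_filter mem_catalan_words; apply/idP/allpairsP.
  case/and3P=> /eqP idx Cw /eqP sz.
  have [|u [v [def_w v0]]] := first_returnP w Cw; first by case: (w) sz.
  move: Cw; rewrite def_w catalan_first_return // => /andP[Cu Cv].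
  have szu : size u = i by rewrite -idx def_w return_index_first_return.
  exists (u, v); rewrite !mem_catalan_words /= Cu Cv szu eqxx; split=> //=.
  by move: sz; rewrite def_w /= size_cat size_map szu => -[<-]; rewrite addKn.
case=> -[u v] /= []; rewrite !mem_catalan_words.
move=> /andP[Cu /eqP szu] /andP[Cv /eqP szv] ->.
have v0 : head 0 v = 0 by case: (v) Cv => //= b v' /catalan_word_head.
rewrite return_index_first_return // szu eqxx catalan_first_return // Cu Cv /=.
by rewrite size_cat size_map szu szv subnKC.
Qed.

Lemma return_index_lt n w : w \in catalan_words n.+1 -> return_index w < n.+1.
Proof.
rewrite mem_catalan_words => /andP[_ /eqP szw].
by rewrite ltnS /return_index (leq_trans (find_size _ _)) // size_behead szw.
Qed.

(** Deleting the last letter inverts the doubling, and a repeated letter never breaks the growth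
    condition. The words on the right are nonempty, so the default of [last] is not reached. *)
Lemma perm_ends_eq n :
  perm_eq [seq w <- catalan_words n.+2 | ends_eq w]
          [seq rcons w (last 0 w) | w <- catalan_words n.+1].
Proof.
apply: uniq_perm; first exact/filter_uniq/catalan_words_uniq.
  rewrite map_inj_uniq ?catalan_words_uniq // => u v.
  by case/rcons_inj.
move=> w; rewrite mem_filter mem_catalan_words; apply/idP/mapP.
  case/and3P; case/lastP: w => // w b; case/lastP: w => // w a.
  rewrite ends_eq_rcons2 => /eqP <-; rewrite size_rcons => Cw /eqP[szw].
  exists (rcons w a); last by rewrite last_rcons.
  rewrite mem_catalan_words szw eqxx andbT; move: Cw {szw}.
  case: w => [|c w]; rewrite /catalan_word /=; first by case/andP=> ->.
  by rewrite (rcons_path _ _ (rcons w a)) => /and3P[-> ->].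
case=> u; rewrite mem_catalan_words => /andP[Cu /eqP szu] ->.
case/lastP: u => // u a in Cu szu *.
rewrite ends_eq_rcons2 last_rcons eqxx size_rcons szu eqxx andbT /=.
move: Cu; rewrite /catalan_word; case: (u) => [|c w'] /=.
  by rewrite leqnSn andbT.
by rewrite (rcons_path _ _ (rcons w' a)) last_rcons leqnSn andbT.
Qed.

(** * Avoidance and descents of a reassembled word *)

Lemma avoids_neq_cons a b w : a != b -> avoiding [:: a, b & w] = avoiding (b :: w).
Proof. by move/negPf=> neq_ab; case: w => // c w; rewrite avoids_cons3 neq_ab. Qed.

Lemma avoids_first_return_nilr u : avoiding (first_return u [::]) = avoiding u.
Proof.
rewrite /first_return cats0; case: u => // a u.
by rewrite avoids_neq_cons // (avoids_map_succn (a :: u)).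
Qed.

Lemma des_first_return_nilr u : des (first_return u [::]) = des u.
Proof.
rewrite /first_return cats0; case: u => // a u.
by rewrite des_cons2 (des_map_succn (a :: u)).
Qed.

(** The new factor is 0, 0 and the next letter [b], if any; here [b <= 0] means that [0 :: v] starts
    with two equal letters. *)
Lemma avoids_first_return_nill v :
  avoiding (first_return [::] (0 :: v)) = ~~ starts_eq (0 :: v) && avoiding (0 :: v).
Proof. by case: v => // b v; rewrite avoids_cons3 /= leqn0 eq_sym. Qed.

Lemma des_first_return_nill v : des (first_return [::] (0 :: v)) = des (0 :: v).
Proof. by rewrite des_cons2. Qed.

(** The leading 0 is below its successor and the last shifted letter is above the second 0, so
    neither begins an equality; only the end of [a :: u] matters at the junction. *)
Lemma avoids_first_return a u v :
  avoiding (first_return (a :: u) (0 :: v)) =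
  [&& avoiding (a :: u), ~~ ends_eq (a :: u) & avoiding (0 :: v)].
Proof.
rewrite avoids_neq_cons // avoids_cat // last_map avoids_neq_cons //.
by rewrite (avoids_map_succn (a :: u)) (ends_eq_map_succn (a :: u)).
Qed.

Lemma des_first_return a u v :
  des (first_return (a :: u) (0 :: v)) = (des (a :: u) + des (0 :: v)).+1.
Proof.
rewrite des_cons2 des_cat last_map des_cons2.
by rewrite (des_map_succn (a :: u)) ltn0 add0n ltn0Sn add1n addnS.
Qed.

End Words.

(** * Generating series over Catalan words and over pairs of them *)

Section CatalanSums.
Variable R : comNzRingType.
Implicit Types F G : seq nat -> R.

Definition catalan_sum F : fps R := Fps (fun n => \sum_(w <- catalan_words n) F w).

(** The kernel is arbitrary so that the weight of a reassembled word can be rewritten pair by pair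
    before the sum factors into products of series. *)
Definition pair_sum (K : seq nat -> seq nat -> R) : fps R :=
  Fps (fun n => \sum_(i < n.+1) \sum_(u <- catalan_words i)
                 \sum_(v <- catalan_words (n - i)) K u v).

Lemma catalan_words0 : catalan_words 0 = [:: [::]].
Proof.
apply: perm_small_eq => //; apply: uniq_perm; rewrite ?catalan_words_uniq //.
by move=> w; rewrite mem_catalan_words inE size_eq0; case: w => // *; rewrite andbF.
Qed.

Lemma catalan_sum_coef0 F : (catalan_sum F)`[0] = F [::].
Proof. by rewrite /= catalan_words0 big_seq1. Qed.

Lemma catalan_sumD F G :
  catalan_sum (fun w => F w + G w) = catalan_sum F + catalan_sum G.
Proof. by apply: fpsP => n /=; rewrite big_split. Qed.

Lemma catalan_sumZ (a : R) F :
  catalan_sum (fun w => a * F w) = fpsC a * catalan_sum F.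
Proof. by apply: fpsP => n; rewrite coef_fpsCM /= big_distrr. Qed.

Lemma catalan_sum_nil : catalan_sum (fun w => (w == [::])%:R) = 1.
Proof.
apply: fpsP => n; rewrite coef_fps1 /=.
case: n => [|n]; first by rewrite catalan_words0 big_seq1.
rewrite big_seq big1 // => w; rewrite mem_catalan_words => /andP[_].
by case: w.
Qed.

(** Nonempty words are sorted by their return index; the leading 0 gives the factor [fpsX]. *)
Lemma catalan_sum_first_return F :
  catalan_sum F = fpsC (F [::]) + fpsX * pair_sum (fun u v => F (first_return u v)).
Proof.
apply: fpsP => -[|n]; rewrite coef_fpsD coef_fpsXM coef_fpsC.
  by rewrite catalan_sum_coef0 addr0.
rewrite add0r /= big_seq.
(* The index of a listed word is below [n.+1], so [inord] preserves it; membership is kept in the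
   sum for this bound. *)
rewrite (partition_big (fun w => inord (return_index w) : 'I_n.+1) predT) //=.
apply: eq_bigr => i _.
have lein : (i <= n)%N by rewrite -ltnS.
rewrite -(big_allpairs_dep (h := first_return)).
rewrite -(perm_big _ (perm_first_return _ _ lein)) big_filter.
rewrite [RHS]big_seq_cond; apply: eq_bigl => w.
have [w_in|//] := boolP (w \in _).
by rewrite -val_eqE /= inordK // return_index_lt.
Qed.

Lemma pair_sumD (K L : seq nat -> seq nat -> R) :
  pair_sum (fun u v => K u v + L u v) = pair_sum K + pair_sum L.
Proof.
apply: fpsP => n /=; rewrite -big_split /=; apply: eq_bigr => i _.
rewrite -big_split /=; apply: eq_bigr => u _.
by rewrite -big_split.
Qed.

Lemma pair_sumM F G : pair_sum (fun u v => F u * G v) = catalan_sum F * catalan_sum G.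
Proof.
apply: fpsP => n; rewrite coef_fpsM /=; apply: eq_bigr => i _.
rewrite big_distrl; apply: eq_bigr => u _.
by rewrite big_distrr.
Qed.

Lemma eq_pair_sum (K L : seq nat -> seq nat -> R) :
  (forall u v, head 0%N v = 0%N -> K u v = L u v) -> pair_sum K = pair_sum L.
Proof.
move=> eqKL; apply: fpsP => n /=; apply: eq_bigr => i _; apply: eq_bigr => u _.
rewrite big_seq [RHS]big_seq; apply: eq_bigr => v.
by rewrite mem_catalan_words => /andP[/andP[/eqP v0 _] _]; apply: eqKL.
Qed.

(** The doubled letter gives the factor [fpsX]. In degree 1 no word ends with two equal letters,
    which matches [F [::] = 0]. *)
Lemma catalan_sum_ends_eq F G :
  (forall a u, G (rcons (rcons u a) a) = F (rcons u a)) ->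
  F [::] = 0 ->
  catalan_sum (fun w => (ends_eq w)%:R * G w) = fpsX * catalan_sum F.
Proof.
move=> GF F0; apply: fpsP => -[|[|n]]; rewrite coef_fpsXM.
- by rewrite catalan_sum_coef0 mul0r.
- rewrite catalan_sum_coef0 F0 /= big_seq big1 // => -[|a [|b w]];
    by rewrite mem_catalan_words ?andbF // mul0r.
transitivity (\sum_(w <- [seq w <- catalan_words n.+2 | ends_eq w]) G w).
  rewrite big_filter big_mkcond; apply: eq_bigr => w _.
  by case: ends_eq; rewrite ?mul1r ?mul0r.
rewrite (perm_big _ (perm_ends_eq n)) big_map /= big_seq [RHS]big_seq.
apply: eq_bigr => w; rewrite mem_catalan_words => /andP[_].
by case/lastP: w => // u a _; rewrite last_rcons GF.
Qed.

End CatalanSums.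

Arguments catalan_sum {R}.
Arguments pair_sum {R}.


(** * Weights, and the equations for P, A and N *)

Local Notation avoiding := (avoids eq_op geq).

Definition weight (w : seq nat) : {poly rat} := (avoiding w)%:R * 'X^(des w).
Definition weight_nil (w : seq nat) : {poly rat} := (w == [::])%:R.
(** This weight and the next two have the series P, A and N, in this order. *)
Definition weight_cons w := (w != [::])%:R * weight w.
Definition weight_neq_start w := ((w != [::]) && ~~ starts_eq w)%:R * weight w.
Definition weight_neq_end w := ((w != [::]) && ~~ ends_eq w)%:R * weight w.

Lemma catalan_gfE : catalan_gf eq_op geq = catalan_sum weight.
Proof.
apply: fpsP => n /=; rewrite big_mkcond; apply: eq_bigr => w _.
by rewrite /weight; case: avoids; rewrite ?mul1r ?mul0r.
Qed.

(** The terms stand for both parts empty, only [v] empty, and neither empty, where the junction is a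
    descent. With only [u] empty the word starts with two 0s and weighs nothing. *)
Lemma weight_neq_start_first_return u v : head 0%N v = 0%N ->
  weight_neq_start (first_return u v) =
    weight_nil u * weight_nil v + weight_cons u * weight_nil v
    + 'X * weight_neq_end u * weight_cons v.
Proof.
rewrite /weight_neq_start /weight_nil /weight_cons /weight_neq_end /weight.
case: u => [|a u]; case: v => [_|b v b0]; rewrite ?(b0 : b = 0%N).
- by rewrite avoids_first_return_nilr des_first_return_nilr /=; ring.
- by rewrite /=; ring.
- by rewrite avoids_first_return_nilr des_first_return_nilr /=; ring.
rewrite avoids_first_return des_first_return exprS exprD.
by case: avoids; case: ends_eq; case: avoids => /=; ring.
Qed.

(** The last term collects the words that start with two equal letters: [u] is empty, [v] is not,
    and the added 0 creates no descent. *)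
Lemma weight_cons_first_return u v : head 0%N v = 0%N ->
  weight_cons (first_return u v) =
    weight_neq_start (first_return u v) + weight_nil u * weight_neq_start v.
Proof.
rewrite /weight_neq_start /weight_nil /weight_cons /weight.
case: u => [|a u]; case: v => [_|b v b0]; rewrite ?(b0 : b = 0%N); try by rewrite /=; ring.
rewrite avoids_first_return_nill des_first_return_nill.
by case: starts_eq; case: avoids => /=; ring.
Qed.

Lemma catalan_sum_cons : catalan_sum weight = 1 + catalan_sum weight_cons.
Proof.
rewrite -catalan_sum_nil -catalan_sumD; congr catalan_sum.
apply: boolp.funext => w.
by case: w => [|a w]; rewrite /weight_cons /weight /= ?mul0r ?mul1r ?addr0 ?add0r.
Qed.

Lemma catalan_sum_neq_start :
  catalan_sum weight_neq_start =
    fpsX * (1 + catalan_sum weight_cons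
            + fpsC 'X * catalan_sum weight_neq_end * catalan_sum weight_cons).
Proof.
rewrite catalan_sum_first_return {1}/weight_neq_start mul0r rmorph0 add0r.
rewrite (eq_pair_sum _ _ _ weight_neq_start_first_return) !pair_sumD !pair_sumM.
by rewrite catalan_sum_nil catalan_sumZ !mulr1.
Qed.

Lemma catalan_sum_cons_start :
  catalan_sum weight_cons =
    catalan_sum weight_neq_start + fpsX * catalan_sum weight_neq_start.
Proof.
rewrite [LHS]catalan_sum_first_return {1}/weight_cons mul0r rmorph0 add0r.
rewrite (eq_pair_sum _ _ _ weight_cons_first_return) pair_sumD pair_sumM mulrDr.
rewrite catalan_sum_nil mul1r; congr (_ + _).
(* What remains is a sum over reassembled words; the decomposition read backwards gives A. *)
by rewrite [RHS]catalan_sum_first_return {2}/weight_neq_start mul0r rmorph0 add0r.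
Qed.

Lemma catalan_sum_cons_end :
  catalan_sum weight_cons =
    catalan_sum weight_neq_end + fpsX * catalan_sum weight_neq_end.
Proof.
(* The second summand becomes the weight of the words ending with two equal letters, which
   complement those counted by N. *)
rewrite -(catalan_sum_ends_eq _ _ weight).
- rewrite -catalan_sumD; congr catalan_sum; apply: boolp.funext => w.
  rewrite /weight_cons /weight_neq_end.
  case: w => [|a w]; first by rewrite /= !mul0r addr0.
  by case: ends_eq => /=; ring.
(* Doubling the last letter adds no descent and keeps avoidance exactly when the word does not
   already end with two equal letters. *)
- move=> a u; rewrite /weight_neq_end.
  have ->: rcons u a != [::] by case: (u).
  rewrite /weight; case: u => [|b u]; last first.
    have := avoids_rcons_last b (rcons u a); have := des_rcons_last b (rcons u a).
    rewrite last_rcons /= => -> ->.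
    by case: avoids; case: ends_eq => /=; ring.
  by rewrite des_cons2 ltnn /= !mul1r.
- by rewrite /weight_neq_end mul0r.
Qed.

(** * The quadratic equation and the choice of its root *)

Theorem theorem3p1 :
  let x : fps {poly rat} := fpsX in
  let y : fps {poly rat} := fpsC 'X in
  2 * x * y * catalan_gf eq_op geq =
    1 - x - x ^+ 2 + 2 * x * y
    - fps_sqrt ((1 - x - x ^+ 2 + 2 * x * y) ^+ 2 - 4 * x * y * (1 + x * y)).
Proof.
move=> x y; set b := 1 - x - _ + _; set C := catalan_gf _ _.
have quadC : x * y * C ^+ 2 - b * C + (1 + x * y) = 0.
  rewrite /b /C catalan_gfE catalan_sum_cons -/x -/y.
  have := catalan_sum_neq_start; have := catalan_sum_cons_start.
  have := catalan_sum_cons_end; rewrite -/x -/y.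
  move: (catalan_sum weight_cons) (catalan_sum weight_neq_start).
  move: (catalan_sum weight_neq_end) => N P A PN PA A_eq.
  have {}PA : P = (1 + x) * A by rewrite {1}PA; ring.
  have {}PN : P = (1 + x) * N by rewrite {1}PN; ring.
  have P_eq : P = x * ((1 + x) * (1 + P) + y * P * P).
    transitivity (x * ((1 + x) * (1 + P) + y * ((1 + x) * N) * P)).
      by rewrite {1}PA A_eq; ring.
    by rewrite -PN.
  transitivity (x * ((1 + x) * (1 + P) + y * P * P) - P); first by ring.
  by rewrite -P_eq subrr.
have unit2 : (2 : {poly rat}) \is a GRing.unit.
  by rewrite -[2](rmorph_nat (@polyC rat)) rmorph_unit // unitfE.
(* The root is [b - 2 * x * y * C]: its constant term 1 selects the sign. *)
rewrite -(@fps_sqrt_uniq _ unit2 _ (b - 2 * x * y * C)); first by ring.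
  have -> : b - 2 * x * y * C = 1 + x * (2 * y - 1 - x - 2 * y * C).
    by rewrite /b; ring.
  by rewrite coef_fpsD coef_fpsXM coef_fps1 addr0.
(* Completing the square; by [quadC] the last bracket equals [- (1 + x * y)]. *)
transitivity (b ^+ 2 + 4 * x * y * (x * y * C ^+ 2 - b * C)); first by ring.
by rewrite (canRL (addrK _) quadC); ring.
Qed.
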